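(* Let $\bm{x}_{n+1}=\bm{\Phi}(\bm{x}_n)$ be a dynamical system preserving a probability measure $\mu$ on the full state space, let $\overline{(\cdot)}$ be a coarse-graining operator, and let $\bar\mu$ be the pushforward of $\mu$ onto the coarse-grained space, assumed to have finite second moment. Assume the coarse-grained initial condition $\overline{\bm{x}}_n$ is distributed as $\bar\mu$ (the full system being stationary with law $\mu$). For each parameter value $\bm{\theta}$, consider the Markovian model initialized from the exact resolved state, $$\widetilde{\bm{x}}_{n+k+1}=\bm{F}_{\bm{\theta}}(\widetilde{\bm{x}}_{n+k},\bm{\xi}_{n+k}),\qquad \widetilde{\bm{x}}_n=\overline{\bm{x}}_n,$$ where the noise variables $\bm{\xi}_n,\bm{\xi}_{n+1},\dots$ are independent, and are generated independently of the true system. Assume further that the coarse-grained state decorrelates under the dynamics in the sense that $$\mathbb{E}\big[\overline{\bm{x}}_{n+m}\mid\overline{\bm{x}}_n\big]\xrightarrow{L^2(\bar\mu)}\mathbb{E}_{\bar\mu}[\overline{\bm{x}}]\qquad\text{as } m\to\infty .$$ Denote the mean-squared-error (MSE) loss at lead time $m$ by $$\mathcal{J}_m(\bm{\theta})=\mathbb{E}\big[\|\widetilde{\bm{x}}_{n+m}-\overline{\bm{x}}_{n+m}\|^2\big].$$ Then this objective admits a decomposition of the form $$\mathcal{J}_m(\bm{\theta})=\mathbb{E}\Big[\big\|\mathbb{E}[\widetilde{\bm{x}}_{n+m}\mid\overline{\bm{x}}_n]-\mathbb{E}[\overline{\bm{x}}_{n+m}\mid\overline{\bm{x}}_n]\big\|^2\Big]+\mathbb{E}\Big[\operatorname{Tr}\big(\operatorname{Cov}(\widetilde{\bm{x}}_{n+m}\mid\overline{\bm{x}}_n)\big)\Big]+C_m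 ,$$ where $C_m$ is independent of $\bm{\theta}$. In particular, predictive variance enters the MSE loss as an additive nonnegative term. Under the stated decorrelation assumption, the target conditional mean $\mathbb{E}[\overline{\bm{x}}_{n+m}\mid\overline{\bm{x}}_n]$ in the first term approaches the climatological mean $\mathbb{E}_{\bar\mu}[\overline{\bm{x}}]$ at long lead times (as $m\to\infty$, in $L^2(\bar\mu)$). Thus, the long-lead contribution to the MSE increasingly favors forecasts with vanishing spread (conditional covariance of $\widetilde{\bm{x}}_{n+m}$ given $\overline{\bm{x}}_n$) and predictive means $\mathbb{E}[\widetilde{\bm{x}}_{n+m}\mid\overline{\bm{x}}_n]$ close to climatology, i.e. close to $\mathbb{E}_{\bar\mu}[\overline{\bm{x}}]$.
   Context: The coarse-graining operator $\bm{x}\mapsto\overline{\bm{x}}$ maps the full state to a lower-dimensional (resolved, or coarse-grained) state vector. The true resolved process is $\overline{\bm{x}}_{n+m}=\overline{\bm{\Phi}^m(\bm{x}_n)}$; it depends on $\overline{\bm{x}}_n$ and also on the unresolved components of $\bm{x}_n$, and is in general not Markov. $\bm{F}_{\bm{\theta}}$ is a deterministic one-step map with parameters $\bm{\theta}$, taking the current model state and a noise input. $\mathbb{E}_{\bar\mu}[\overline{\bm{x}}]$ is the mean of $\bar\mu$, called the climatological mean. $\|\cdot\|$ is the Euclidean norm, and $\operatorname{Cov}(\cdot\mid\overline{\bm{x}}_n)$ is the conditional covariance matrix given $\overline{\bm{x}}_n$. Conditional expectations given $\overline{\bm{x}}_n$ are regarded as functions of $\overline{\bm{x}}_n\sim\bar\mu$,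 which is the sense of convergence in $L^2(\bar\mu)$. *)

(* Defs.v *)
From HB Require Import structures.
From mathcomp Require Import all_boot all_order all_algebra finmap.
From mathcomp Require Import all_classical all_reals all_analysis measurable_realfun.

Set Implicit Arguments.
Unset Strict Implicit.
Unset Printing Implicit Defensive.

Import Order.TTheory GRing.Theory Num.Theory.
Import numFieldNormedType.Exports.

Local Open Scope classical_set_scope.
Local Open Scope ring_scope.
Local Open Scope ereal_scope.

Section euclidean.
Context {R : realType} {d : nat}.

(* Vectors of R^d are tuples, which carry the product (= Borel) sigma-algebra.
   Their coordinates are embedded in \bar R because the conditional means of a
   non-integrable vector may be infinite. *)
Definition evec (v : d.-tuple R) : 'I_d -> \bar R := fun i => (tnth v i)%:E.

(* squared Euclidean norm *)
Definition sqnorm (v : 'I_d -> \bar R) : \bar R := \sum_(i < d) v i ^+ 2.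

Definition mean_vec (nu : probability (d.-tuple R) R) : 'I_d -> \bar R :=
  fun i => \int[nu]_y evec y i.

End euclidean.

Section independence.
Context {dO dE : measure_display} {Omega : measurableType dO}
  {E : measurableType dE} {R : realType} (P : probability Omega R).

Definition mutually_independent (I : choiceType) (X : I -> {RV P >-> E}) :=
  forall (J : {fset I}) (A : I -> set E), (forall i, measurable (A i)) ->
    P (\bigcap_(i in [set` J]) X i @^-1` A i) =
    \prod_(i <- J) P (X i @^-1` A i).

Definition sigma_process (I : Type) (X : I -> {RV P >-> E}) :
    set (set Omega) :=
  <<s \bigcup_i preimage_set_system setT (X i) measurable >>.

Definition independent_sigma (G H : set (set Omega)) :=
  forall A B, G A -> H B -> P (A `&` B) = P A * P B.

End independence.

Section conditional_expectation.
Context {dO dS : measure_display} {Omega : measurableType dO}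
  {S : measurableType dS} {R : realType} (P : probability Omega R)
  (X : {RV P >-> S}).

(* g is a version of y |-> E[f | X = y], for f with values in [0, +oo] *)
Definition is_ge0_condexp (f : Omega -> \bar R) (g : S -> \bar R) :=
  [/\ measurable_fun setT g, (forall y, 0 <= g y) &
      forall B, measurable B ->
        \int[P]_(w in X @^-1` B) f w = \int[distribution P X]_(y in B) g y].

Definition ge0_condexp (f : Omega -> \bar R) : S -> \bar R :=
  xget (cst 0) [set g | is_ge0_condexp f g].

(* As for the Lebesgue integral, signed functions are handled through their
   positive and negative parts, so that no integrability is required for the
   definition to make sense; it is the usual one for integrable f. *)
Definition condexp (f : Omega -> \bar R) : S -> \bar R :=
  fun y => ge0_condexp f^\+ y - ge0_condexp f^\- y.

Context {d : nat}.

Definition condmean (Z : Omega -> d.-tuple R) (y : S) : 'I_d -> \bar R :=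
  fun i => condexp (fun w => evec (Z w) i) y.

Definition condcov (Z : Omega -> d.-tuple R) (y : S) : 'M[\bar R]_d :=
  \matrix_(i, j) condexp (fun w =>
    (evec (Z w) i - condmean Z (X w) i) *
    (evec (Z w) j - condmean Z (X w) j)) y.

End conditional_expectation.

Section forecast.
Context {dT dO dE : measure_display} {T : measurableType dT}
  {Omega : measurableType dO} {E : measurableType dE} {R : realType} {d : nat}
  (P : probability Omega R).

Definition resolved (cg : {mfun T >-> d.-tuple R}) (x : nat -> {RV P >-> T})
    (k : nat) : {RV P >-> d.-tuple R} := cg \o x k.

(* [model f s xi k] is the model state k steps after the initial state s; it
   uses the noise variables xi 0, ..., xi (k - 1). *)
Fixpoint model (f : {mfun (d.-tuple R * E)%type >-> d.-tuple R})
    (s : {RV P >-> d.-tuple R}) (xi : nat -> {RV P >-> E}) (k : nat)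
    (w : Omega) : d.-tuple R :=
  if k is k'.+1 then f (model f s xi k' w, xi k' w) else s w.

End forecast.

(* Main.v *)
(* Each coordinate Z of the forecast is a function of the initial resolved state
   X and of the noise, while the residual D = Y - E[Y | X] of the matching true
   coordinate Y is a function of the true system.  D has zero mean on every event
   of X, hence, by independence and a pi-lambda argument, on every event
   generated by X and the noise, so it is orthogonal to every square integrable
   function of Z.  Expanding
     Z - Y = (Z - E[Z | X]) + (E[Z | X] - E[Y | X]) - D
   gives the decomposition, C_m being the sum over the coordinates of E[D^2].
   When Z is not square integrable, both sides are infinite.  The long-lead
   statements follow from Young's inequality, which compares the squared distances
   of the predictive mean to E[Y | X] and to the climatological mean up to a
   factor 1 + eta and a multiple of the decorrelation error. *)

Require Import Defs.
From HB Require Import structures.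
From mathcomp Require Import all_boot all_order all_algebra finmap.
From mathcomp Require Import all_classical all_reals all_analysis measurable_realfun.
From mathcomp Require Import ring lra.

Set Implicit Arguments.
Unset Strict Implicit.
Unset Printing Implicit Defensive.

Import Order.TTheory GRing.Theory Num.Theory.
Import numFieldNormedType.Exports.

Local Open Scope classical_set_scope.
Local Open Scope ring_scope.
Local Open Scope ereal_scope.

(** * Orthogonality: from zero mean on the events of [V] to functions of [V] *)

Section orthogonality.
Context {dO dS : measure_display} {Omega : measurableType dO}
  {S : measurableType dS} {R : realType} (mu : {measure set Omega -> \bar R}).
Variables (V : Omega -> S) (D : Omega -> R).
Hypotheses (mV : measurable_fun setT V)
  (iD : mu.-integrable setT (EFin \o D))
  (D0 : forall A, measurable A -> \int[mu]_(w in V @^-1` A) (D w)%:E = 0).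

Let mVA A : measurable A -> measurable (V @^-1` A).
Proof. by move=> mA; rewrite -[_ @^-1` _]setTI; exact: mV. Qed.

Let mD : measurable_fun setT D.
Proof. by apply/measurable_EFinP; exact: measurable_int iD. Qed.

Import HBNNSimple.

(** [h] is a finite combination of indicators of its level sets, and [D0] cancels the integral of
    [D] over the preimage by [V] of each of them. *)
Let integral_mul_nnsfun (h : {nnsfun S >-> R}) :
  \int[mu]_w (D w * h (V w))%:E = 0.
Proof.
pose A y := V @^-1` (h @^-1` [set y]).
have mA y : measurable (A y) by exact: mVA.
have iA y : mu.-integrable setT (fun w => (\1_(A y) w)%:E * (D w)%:E).
  have := integrableS measurableT (mA y) (@subsetT _ _) iD.
  rewrite (integrable_mkcond _ (mA y)); apply: eq_integrable => // w _.
  by rewrite epatch_indic/= muleC.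
under eq_integral => w _.
  rewrite fimfunE fsbig_finite//= mulr_sumr -sumEFin.
  under eq_bigr => y _.
    rewrite (_ : _%:E = y%:E * ((\1_(A y) w)%:E * (D w)%:E)); last first.
      rewrite -!EFinM; congr _%:E.
      rewrite -[\1_(A y) w]/(\1_(h @^-1` [set y]) (V w)) mulrC -mulrA.
      by [].
    over.
  over.
rewrite integral_sum//=; last by move=> y; exact: integrableZl.
rewrite big1// => y _; rewrite integralZl//.
under eq_integral do rewrite muleC.
rewrite (eq_integral ((EFin \o D) \_ (A y))); last first.
  by move=> w _; rewrite epatch_indic.
by rewrite -integral_mkcond D0 ?mule0.
Qed.

(** Dominated convergence: simple functions increase to [h], so the integrable function [|D h(V)|]
    dominates all the approximating products. *)
Let ge0_integral_mul_comp (h : S -> R) : measurable_fun setT h ->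
  (forall s, 0 <= h s)%R ->
  mu.-integrable setT (fun w => (D w * h (V w))%:E) ->
  \int[mu]_w (D w * h (V w))%:E = 0.
Proof.
move=> mh h0 iDh.
have meh : measurable_fun setT (EFin \o h) by exact/measurable_EFinP.
pose hn := nnsfun_approx measurableT meh.
have [|||||_ _ +] := @dominated_convergence _ _ _ mu setT measurableT
  (fun n w => (D w * hn n (V w))%:E) (fun w => (D w * h (V w))%:E)
  (fun w => `|(D w * h (V w))%:E|).
- move=> n; apply/measurable_EFinP/measurable_funM => //.
  exact: measurableT_comp mV.
- exact: measurable_int iDh.
- apply: aeW => w _; apply: cvg_EFin; first by exact: nearW.
  apply: cvgMl_tmp => /=.
  have := cvg_nnsfun_approx measurableT meh (fun s _ => h0 s)
    (x := V w) Logic.I.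
  by move/fine_cvg.
- exact: integrable_abse.
- apply: aeW => w n _; rewrite !abse_EFin lee_fin !normrM ler_wpM2l//.
  rewrite !ger0_norm//.
  have /nondecreasing_cvgn_le : nondecreasing_seq (fun k => hn k (V w)).
    by move=> k l kl; exact/lefP/nd_nnsfun_approx.
  have /fine_cvg hnh :=
    cvg_nnsfun_approx measurableT meh (fun s _ => h0 s) (x := V w) Logic.I.
  move=> /(_ (cvgP _ hnh) n); rewrite (cvg_lim _ hnh)//.
rewrite [X in X @ _ --> _](_ : _ = cst 0); last first.
  by apply/funext => n /=; exact: integral_mul_nnsfun.
by move=> /cvg_lim <- //; rewrite lim_cst.
Qed.

(** Both parts of [h] are bounded by [|h|], so their products with [D] inherit integrability and the
    nonnegative case applies to each. *)
Lemma integral_mul_comp (h : S -> R) : measurable_fun setT h ->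
  mu.-integrable setT (fun w => (D w * h (V w))%:E) ->
  \int[mu]_w (D w * h (V w))%:E = 0.
Proof.
move=> mh iDh.
have mhV : measurable_fun setT (h \o V) by exact: measurableT_comp.
have ip : mu.-integrable setT (fun w => (D w * (h^\+ (V w))%R)%:E).
  apply: le_integrable iDh => //.
    apply/measurable_EFinP/measurable_funM => //.
    exact: (measurable_funrpos mhV).
  move=> w _; rewrite !abse_EFin lee_fin !normrM ler_wpM2l//.
  by rewrite ger0_norm ?funrpos_ge0// /funrpos ge_max ler_norm normr_ge0.
have in_ : mu.-integrable setT (fun w => (D w * (h^\- (V w))%R)%:E).
  apply: le_integrable iDh => //.
    apply/measurable_EFinP/measurable_funM => //.
    exact: (measurable_funrneg mhV).
  move=> w _; rewrite !abse_EFin lee_fin !normrM ler_wpM2l//.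
  by rewrite ger0_norm ?funrneg_ge0// /funrneg ge_max -normrN ler_norm
    normr_ge0.
under eq_integral => w _.
  rewrite [h (V w)](_ : _ = (h^\+ (V w) - h^\- (V w))%R); last first.
    by rewrite -[in LHS](funrposBneg h).
  rewrite mulrBr EFinB; over.
rewrite integralB// !ge0_integral_mul_comp ?sube0//.
- exact: measurable_funrneg.
- exact: measurable_funrpos.
Qed.

End orthogonality.

(** * Existence of conditional expectations of nonnegative functions *)

Section ge0_condexp_existence.
Context {dO dS : measure_display} {Omega : measurableType dO}
  {S : measurableType dS} {R : realType} (P : probability Omega R)
  (X : {RV P >-> S}).

(** Radon-Nikodym: the image under [X] of the measure with density [f] is finite and vanishes on the
    null sets of the law of [X]; its density with respect to that law is the required version. *)
Lemma exists_finite_ge0_condexp (f : Omega -> \bar R) :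
  measurable_fun setT f -> (forall w, 0 <= f w) -> \int[P]_w f w < +oo ->
  exists g, is_ge0_condexp X f g.
Proof.
move=> mf f0 fi.
pose m B := \int[P]_(w in X @^-1` B) f w.
have m0 : m set0 = 0 by rewrite /m preimage_set0 integral_set0.
have mge0 B : 0 <= m B by apply: integral_ge0 => w _.
have msigma : semi_sigma_additive m.
  move=> F mF tF mUF; rewrite /m preimage_bigcup.
  apply: (@semi_sigma_additive_nng_induced _ _ _ P f mf f0
    (fun n => X @^-1` F n)).
  - by move=> n; exact: measurable_funPTI.
  - apply/trivIsetP => i j _ _ ij; rewrite -preimage_setI.
    by move/trivIsetP : tF => ->//; rewrite preimage_set0.
  - by rewrite -preimage_bigcup; exact: measurable_funPTI.
pose m1 : {measure set S -> \bar R} :=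
  HB.pack m (isMeasure.Build _ _ _ m m0 mge0 msigma).
have m1fin : fin_num_fun m1.
  move=> B mB; rewrite ge0_fin_numE//; apply: le_lt_trans fi.
  by apply: ge0_subset_integral => //; exact: measurable_funPTI.
pose m2 : {finite_measure set S -> \bar R} :=
  HB.pack m (isMeasure.Build _ _ _ m m0 mge0 msigma)
    (Measure_isFinite.Build _ _ _ m1 m1fin).
have m2X : m2 `<< distribution P X.
  apply/null_content_dominatesP => B mB PB.
  by apply: null_set_integral; [exact: measurable_funPTI|
    exact: measurable_funTS|].
have [g [g0 _ ig gE]] := radon_nikodym_sigma_finite m2X.
by exists g; split => //; exact: measurable_int ig.
Qed.

Lemma exists_ge0_condexp (f : Omega -> \bar R) :
  measurable_fun setT f -> (forall w, 0 <= f w) ->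
  exists g, is_ge0_condexp X f g.
Proof.
move=> mf f0.
(* The increments of the truncations [mine (f w) n] are integrable and sum to
   [f], which may itself be infinite or non-integrable. *)
pose u n w := mine (f w) n%:R%:E.
have un0 n w : 0 <= u n w by rewrite le_min f0 lee_fin/=.
have ufin n w : u n w \is a fin_num.
  by rewrite ge0_fin_numE// (le_lt_trans _ (ltry n%:R))// ge_min lexx orbT.
have uS n w : u n w <= u n.+1 w.
  by rewrite le_min !ge_min lexx/= lee_fin ler_nat leqnSn orbT.
have mu n : measurable_fun setT (u n).
  by apply: measurable_mine => //; exact: measurable_cst.
pose v n w := u n.+1 w - u n w.
have v0 n w : 0 <= v n w by rewrite sube_ge0 ?ufin.
have mv n : measurable_fun setT (v n) by exact: emeasurable_funB.
have vi n : \int[P]_w v n w < +oo.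
  apply: (@le_lt_trans _ _ (\int[P]_w (n.+1%:R%:E))).
    apply: ge0_le_integral => // w _.
    rewrite /v leeBlDr ?ufin// (@le_trans _ _ n.+1%:R%:E)//.
      by rewrite ge_min lexx orbT.
    by rewrite leeDl.
  by rewrite integral_cst// [X in _ * X](@probability_setT _ _ _ P) mule1 ltry.
have fE w : f w = \sum_(n <oo) v n w.
  apply/esym/cvg_lim => //.
  rewrite (_ : (fun n => _) = u ^~ w); last first.
    apply/funext => k; rewrite telescope_sume//=.
    by rewrite /u /= (min_idPr (f0 w)) sube0.
  (* A finite value is attained by all truncations of large index; for an infinite value the
     truncation of index [n] is [n] itself. *)
  have := f0 w; rewrite /u; case: (f w) => [r r0|_|//].
    apply: (@cvg_trans _ (r%:E @[_ --> \oo])); last exact: cvg_cst.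
    apply: near_eq_cvg; near=> k; apply/esym/min_idPl; rewrite lee_fin.
    by near: k; exact: nbhs_infty_ger.
  under eq_fun do rewrite minye.
  exact/cvgenyP.
have /choice[g gP] n := exists_finite_ge0_condexp (mv n) (v0 n) (vi n).
exists (fun y => \sum_(n <oo) g n y); split.
- apply: ge0_emeasurable_sum => // [n y _ _|n _]; by case: (gP n).
- by move=> y; apply: nneseries_ge0 => n _ _; case: (gP n).
- move=> B mB; under eq_integral do rewrite fE.
  rewrite !integral_nneseries//.
  + apply: eq_eseriesr => n _; by case: (gP n) => _ _; exact.
  + by move=> n; apply: measurable_funTS; case: (gP n).
  + by move=> n y _; case: (gP n).
  + exact: measurable_funPTI.
  + by move=> n; apply: measurable_funTS.
Unshelve. all: by end_near. Qed.

End ge0_condexp_existence.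

(** * Square integrable random variables *)

Section square_integrable.
Context {dO : measure_display} {Omega : measurableType dO} {R : realType}
  (P : probability Omega R).

Definition square_integrable (f : Omega -> R) :=
  measurable_fun setT f /\ P.-integrable setT (fun w => (f w ^+ 2)%:E).

(** Domination: [|f g| <= f^2 + g^2]. *)
Lemma integrable_mulr (f g : Omega -> R) :
  square_integrable f -> square_integrable g ->
  P.-integrable setT (fun w => (f w * g w)%:E).
Proof.
move=> [mf f2] [mg g2]; apply: le_integrable
  (integrableD measurableT f2 g2) => //.
  exact/measurable_EFinP/measurable_funM.
move=> w _; rewrite -EFinD !abse_EFin lee_fin.
rewrite [leRHS]ger0_norm ?addr_ge0 ?sqr_ge0//.
by rewrite ler_norml; apply/andP; split; nra.
Qed.

Lemma square_integrable_cst (r : R) : square_integrable (cst r).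
Proof.
by split => //; exact: (finite_measure_integrable_cst P (r ^+ 2) measurableT).
Qed.

Lemma square_integrable_integrable (f : Omega -> R) :
  square_integrable f -> P.-integrable setT (EFin \o f).
Proof.
move=> f2; have := integrable_mulr f2 (square_integrable_cst 1%R).
by apply: eq_integrable => // w _ /=; rewrite mulr1.
Qed.

Lemma square_integrableZ (k : R) (f : Omega -> R) :
  square_integrable f -> square_integrable (fun w => k * f w)%R.
Proof.
move=> [mf f2]; split; first exact: measurable_funM.
have := integrableZl measurableT (k ^+ 2) f2.
by apply: eq_integrable => // w _; rewrite exprMn EFinM.
Qed.

Lemma square_integrableD (f g : Omega -> R) :
  square_integrable f -> square_integrable g ->
  square_integrable (fun w => f w + g w)%R.
Proof.
move=> f2 g2; have fg := integrableZl measurableT 2 (integrable_mulr f2 g2).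
case: f2 g2 => [mf f2] [mg g2]; split; first exact: measurable_funD.
have := integrableD measurableT (integrableD measurableT f2 g2) fg.
by apply: eq_integrable => // w _ /=; rewrite -EFinM -!EFinD; congr _%:E; ring.
Qed.

Lemma square_integrableB (f g : Omega -> R) :
  square_integrable f -> square_integrable g ->
  square_integrable (fun w => f w - g w)%R.
Proof.
move=> f2 g2.
have := square_integrableD f2 (square_integrableZ (- 1) g2).
by congr square_integrable; apply/funext => w; rewrite mulN1r.
Qed.

End square_integrable.

(** * Conditional expectations and their real-valued versions *)

Section condexp_theory.
Context {dO dS : measure_display} {Omega : measurableType dO}
  {S : measurableType dS} {R : realType} (P : probability Omega R)
  (X : {RV P >-> S}).

Lemma ge0_condexpP (f : Omega -> \bar R) :
  measurable_fun setT f -> (forall w, 0 <= f w) ->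
  is_ge0_condexp X f (ge0_condexp X f).
Proof. by move=> mf f0; apply: xgetPex; exact: exists_ge0_condexp. Qed.

Lemma integral_ge0_condexp (f : Omega -> \bar R) (B : set S) :
  measurable_fun setT f -> (forall w, 0 <= f w) -> measurable B ->
  \int[P]_(w in X @^-1` B) ge0_condexp X f (X w) =
  \int[P]_(w in X @^-1` B) f w.
Proof.
move=> mf f0 mB; have [mg g0 ->//] := ge0_condexpP mf f0.
by rewrite ge0_integral_pushforward//; exact: measurable_funTS.
Qed.

Lemma measurable_condexp (f : Omega -> \bar R) :
  measurable_fun setT f -> measurable_fun setT (condexp X f).
Proof.
move=> mf; apply: emeasurable_funB.
- by case: (@ge0_condexpP f^\+) => //; exact: measurable_funepos.
- by case: (@ge0_condexpP f^\-) => //; exact: measurable_funeneg.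
Qed.

Let measurable_ge0_condexp (f : Omega -> \bar R) :
  measurable_fun setT f -> (forall w, 0 <= f w) ->
  measurable_fun setT (ge0_condexp X f).
Proof. by move=> mf f0; case: (ge0_condexpP mf f0). Qed.

Let ge0_condexp_ge0 (f : Omega -> \bar R) y :
  measurable_fun setT f -> (forall w, 0 <= f w) -> 0 <= ge0_condexp X f y.
Proof. by move=> mf f0; case: (ge0_condexpP mf f0). Qed.

(** The chosen version may be infinite on a null set, where [fine] puts 0; the integrals are
    unchanged. *)
Let finite_part (f : Omega -> \bar R) :
  P.-integrable setT f -> (forall w, 0 <= f w) ->
  [/\ P.-integrable setT (fun w => (fine (ge0_condexp X f (X w)))%:E),
      {ae P, forall w, ge0_condexp X f (X w) =
                       (fine (ge0_condexp X f (X w)))%:E} &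
      forall B, measurable B ->
        \int[P]_(w in X @^-1` B) (fine (ge0_condexp X f (X w)))%:E =
        \int[P]_(w in X @^-1` B) f w].
Proof.
move=> fi f0; have mf := measurable_int _ fi.
have mg := measurable_ge0_condexp mf f0.
have mgX : measurable_fun setT (fun w => ge0_condexp X f (X w)).
  exact: measurableT_comp.
have gi : P.-integrable setT (fun w => ge0_condexp X f (X w)).
  apply/integrableP; split => //.
  under eq_integral do rewrite gee0_abs ?ge0_condexp_ge0//.
  have := integral_ge0_condexp mf f0 measurableT; rewrite preimage_setT => ->.
  have /integrableP[_] := fi.
  by under eq_integral do rewrite gee0_abs//.
have mfg : measurable_fun setT (fun w => (fine (ge0_condexp X f (X w)))%:E).
  by apply/measurable_EFinP; exact: measurableT_comp mgX.
have ae : {ae P, forall w, ge0_condexp X f (X w) =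
                           (fine (ge0_condexp X f (X w)))%:E}.
  have := integrable_ae measurableT gi.
  by apply: filterS => w /(_ Logic.I) /fineK ->.
split => //.
- apply: le_integrable gi => // w _.
  by case: (ge0_condexp X f (X w)) => //=; rewrite normr0 leey.
- move=> B mB; rewrite -(integral_ge0_condexp mf f0 mB).
  apply: ae_eq_integral; [exact: measurable_funPTI|exact: measurable_funTS..|].
  by apply: filterS ae => w -> _.
Qed.

(** [m] is the difference of the real versions for the two parts of [Z]; [condexp] may meet infinite
    values on a null set, hence an equality almost everywhere only. *)
Lemma exists_finite_condexp (Z : Omega -> R) :
  P.-integrable setT (EFin \o Z) ->
  exists m : S -> R, [/\ measurable_fun setT m,
    {ae P, forall w, condexp X (EFin \o Z) (X w) = (m (X w))%:E},
    P.-integrable setT (fun w => (m (X w))%:E) &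
    forall B, measurable B ->
      \int[P]_(w in X @^-1` B) (Z w - m (X w))%:E = 0].
Proof.
move=> Zi; have mZ := measurable_int _ Zi.
have Zp := integrable_funepos measurableT Zi.
have Zn := integrable_funeneg measurableT Zi.
have [pi pae pE] := finite_part Zp (funepos_ge0 _).
have [ni nae nE] := finite_part Zn (funeneg_ge0 _).
set p := ge0_condexp X _ in pi pae pE; set q := ge0_condexp X _ in ni nae nE.
have mp : measurable_fun setT p.
  by apply: measurable_ge0_condexp (measurable_int _ Zp) _.
have mq : measurable_fun setT q.
  by apply: measurable_ge0_condexp (measurable_int _ Zn) _.
exists (fun y => fine (p y) - fine (q y))%R; split.
- by apply: measurable_funB; exact: measurableT_comp.
- by apply: filterS2 pae nae => w pw nw; rewrite /condexp EFinB -pw -nw.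
- by have := integrableB measurableT pi ni; apply: eq_integrable.
- move=> B mB; have mXB : measurable (X @^-1` B) by exact: measurable_funPTI.
  have iB f : P.-integrable setT f -> P.-integrable (X @^-1` B) f.
    exact: integrableS.
  under eq_integral do rewrite EFinB EFinB.
  rewrite integralB//; [|exact: iB|by apply: iB; exact: integrableB].
  rewrite integralB//; [|exact: iB..].
  rewrite pE// nE// -integralE subee//.
  by apply: integrable_fin_num => //; exact: iB.
Qed.

(** The last clause has the form of the hypothesis [D0] of [integral_mul_comp], for the residual
    [Z - m(X)]. *)
Definition is_L2_condexp (Z : Omega -> R) (m : S -> R) :=
  [/\ measurable_fun setT m,
    {ae P, forall w, condexp X (EFin \o Z) (X w) = (m (X w))%:E},
    square_integrable P (m \o X) &
    forall B, measurable B ->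
      \int[P]_(w in X @^-1` B) (Z w - m (X w))%:E = 0].

Lemma exists_L2_condexp (Z : Omega -> R) :
  square_integrable P Z ->
  exists m : S -> R, is_L2_condexp Z m.
Proof.
move=> Z2; have Zi := square_integrable_integrable Z2.
have [m [mm mae mi mB]] := exists_finite_condexp Zi.
exists m; split => //.
(* Testing [Z - m(X)] against the truncations [h k] of [m], which satisfy
   [h^2 = m h], gives [E[h(X)^2] <= E[Z^2]]. *)
pose h k y := (m y * \1_[set y | `|m y| <= k%:R] y)%R.
have mA k : measurable [set y | (`|m y| <= k%:R)%R].
  rewrite [X in measurable X](_ : _ = (Num.norm \o m) @^-1` `]-oo, k%:R]).
    by rewrite -[_ @^-1` _]setTI;
       apply: (measurableT_comp (@normr_measurable R setT) mm).
  by apply/seteqP; split => y /=; rewrite in_itv.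
have mh k : measurable_fun setT (h k) by exact: measurable_funM.
have mhX k : measurable_fun setT (fun w => h k (X w)).
  exact: measurableT_comp.
have hk k y : (`|h k y| <= k%:R)%R.
  rewrite /h indicE; case: (boolP (y \in _)); first by rewrite inE mulr1.
  by rewrite mulr0 normr0.
have hmh k y : (h k y ^+ 2 = m y * h k y)%R.
  rewrite /h indicE; case: (boolP (y \in _)); rewrite ?mulr1 ?mulr0 ?expr2//.
  by rewrite mulr0.
have Di : P.-integrable setT (fun w => (Z w - m (X w))%:E).
  by have := integrableB measurableT Zi mi; exact: eq_integrable.
have hD k : P.-integrable setT (fun w => ((Z w - m (X w)) * h k (X w))%:E).
  have := integrableZl measurableT k%:R Di.
  apply: le_integrable => //.
    by apply/measurable_EFinP/measurable_funM => //;
       apply/measurable_EFinP; exact: measurable_int Di.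
  move=> w _; rewrite -EFinM !abse_EFin lee_fin.
  rewrite [in leLHS]mulrC (normrM (h k (X w))) normrM.
  by rewrite ler_wpM2r// (le_trans (hk _ _))// ler_norm.
have h2 k : P.-integrable setT (fun w => (h k (X w) ^+ 2)%:E).
  apply: (@le_integrable _ _ _ P setT _ _ (cst (k%:R ^+ 2)%:E)) => //.
  - exact/measurable_EFinP/measurable_funX.
  - move=> w _; rewrite !abse_EFin lee_fin !normrX ler_pXn2r ?nnegrE//.
    by rewrite (le_trans (hk _ _))// ler_norm.
  - exact: (finite_measure_integrable_cst P (k%:R ^+ 2) measurableT).
have bound k : \int[P]_w (h k (X w) ^+ 2)%:E <= \int[P]_w (Z w ^+ 2)%:E.
  (* The zero quantity [2 E[(Z - m(X)) h(X)]] is added on the left; since [m h = h^2], the integrand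
     becomes [2 Z h - h^2], which is at most [Z^2]. *)
  rewrite -[leLHS]adde0 -[X in _ + X](mule0 2%:E).
  have /= <- := integral_mul_comp (measurable_funPT X) Di mB (mh k) (hD k).
  rewrite -integralZl// -integralD//; last exact: integrableZl.
  apply: le_integral => //; last 1 first.
  - move=> w _; rewrite -EFinM -EFinD lee_fin.
    by have := hmh k (X w); have := sqr_ge0 (Z w - h k (X w)); nra.
  - by apply: integrableD => //; exact: integrableZl.
  - by case: Z2.
split; first exact: measurableT_comp.
apply/integrableP; split.
  by apply/measurable_EFinP/measurable_funX; exact: measurableT_comp.
under eq_integral do rewrite gee0_abs ?lee_fin ?sqr_ge0//=.
apply: (@le_lt_trans _ _ (\int[P]_w (Z w ^+ 2)%:E)); last first.
  by case: Z2 => _ ?; exact: integrable_lty.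
have cv : \int[P]_w (h k (X w) ^+ 2)%:E @[k --> \oo] -->
    \int[P]_w (m (X w) ^+ 2)%:E.
  rewrite [X in _ --> X](_ : _ =
    \int[P]_w (limn (fun k => (h k (X w) ^+ 2)%:E))).
    apply: cvg_monotone_convergence => //.
    - by move=> k; apply/measurable_EFinP/measurable_funX.
    - by move=> k w _; rewrite lee_fin sqr_ge0.
    - move=> w _ k l kl; rewrite lee_fin /h !indicE.
      case: (boolP (X w \in _)); last by rewrite mulr0 expr0n/= sqr_ge0.
      rewrite inE/= => mk; rewrite mem_set//=.
      by rewrite (le_trans mk)// ler_nat.
  apply: eq_integral => w _; apply/esym/cvg_lim => //.
  apply: (@cvg_trans _ ((m (X w) ^+ 2)%:E @[_ --> \oo])); last exact: cvg_cst.
  apply: near_eq_cvg; near=> k; rewrite /h indicE mem_set ?mulr1//=.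
  by near: k; exact: nbhs_infty_ger.
rewrite -(cvg_lim _ cv)//; apply: lime_le.
  by apply/cvg_ex; eexists; exact: cv.
by apply: nearW.
Unshelve. all: by end_near. Qed.

(** [condexp] also subtracts [ge0_condexp X (cst 0)], an arbitrarily chosen version: it is
    nonnegative with zero integral, hence zero almost everywhere. *)
Lemma ae_condexp_ge0 (f : Omega -> \bar R) :
  measurable_fun setT f -> (forall w, 0 <= f w) ->
  {ae P, forall w, condexp X f (X w) = ge0_condexp X f (X w)}.
Proof.
move=> mf f0.
have fp : f^\+ = f.
  by apply/funext => w; rewrite (ge0_funeposE (D := setT)) ?inE//.
have fn : f^\- = cst 0.
  by apply/funext => w; rewrite (ge0_funenegE (D := setT)) ?inE//.
have m0 : measurable_fun setT (cst 0 : Omega -> \bar R) by [].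
have c0 w : 0 <= ge0_condexp X (cst 0) (X w) by exact: ge0_condexp_ge0.
have mc : measurable_fun setT (fun w => ge0_condexp X (cst 0) (X w)).
  by apply: measurableT_comp => //; exact: measurable_ge0_condexp.
have /(ae_eq_integral_abs P measurableT mc) :
    \int[P]_w `|ge0_condexp X (cst 0) (X w)| = 0.
  under eq_integral do rewrite gee0_abs//.
  have := integral_ge0_condexp m0 (fun=> lexx 0) measurableT.
  by rewrite preimage_setT => ->; rewrite integral0.
by apply: filterS => w /(_ Logic.I) /= c0w; rewrite /condexp fp fn c0w sube0.
Qed.

End condexp_theory.

(** * Zero-mean variables on events that involve an independent noise *)

Section independence_theory.
Context {dO dS : measure_display} {Omega : measurableType dO}
  {S : measurableType dS} {R : realType} (P : probability Omega R)
  (X : {RV P >-> S}).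
Variables G H : set (set Omega).
Hypotheses (GH : independent_sigma P <<s H >> <<s G >>)
  (mH : H `<=` measurable).

Let measurable_H N : <<s H >> N -> measurable N.
Proof. by apply: smallest_sub => //; exact: sigma_algebra_measurable. Qed.

(** [integral_mul_comp] is used with [D] as the conditioning variable: by independence [1_N - P(N)]
    has zero mean on the events of [D], so it is orthogonal to [D] itself, and [E[D] = 0] removes
    the constant. *)
Lemma integral_independent (D : Omega -> R) (N : set Omega) :
  square_integrable P D ->
  measurable_fun setT (D : g_sigma_algebraType G -> R) ->
  \int[P]_w (D w)%:E = 0 -> <<s H >> N -> \int[P]_(w in N) (D w)%:E = 0.
Proof.
move=> D2 GD D0 HN; have mN := measurable_H HN.
have [mD _] := D2; have Di := square_integrable_integrable D2.
have PN : (fine (P N))%:E = P N by rewrite fineK// fin_num_measure.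
have Ni : P.-integrable setT (fun w => (\1_N w)%:E).
  by apply: integrable_indic.
have ci := finite_measure_integrable_cst P (fine (P N)) measurableT.
pose I w := (\1_N w - fine (P N))%R.
have Ii : P.-integrable setT (EFin \o I).
  by have := integrableB measurableT Ni ci; exact: eq_integrable.
have NDi : P.-integrable setT (fun w => (\1_N w)%:E * (D w)%:E).
  have := integrableS measurableT mN (@subsetT _ _) Di.
  rewrite (integrable_mkcond _ mN); apply: eq_integrable => // w _.
  by rewrite epatch_indic/= muleC.
have cDi : P.-integrable setT (fun w => (fine (P N))%:E * (D w)%:E).
  exact: integrableZl.
have I0 A : measurable A -> \int[P]_(w in D @^-1` A) (I w)%:E = 0.
  move=> mA; have mDA : measurable (D @^-1` A).
    by rewrite -[_ @^-1` _]setTI; exact: mD.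
  under eq_integral do rewrite EFinB.
  rewrite integralB//; [|exact: integrableS Ni|exact: integrableS ci].
  rewrite integral_indic// integral_cst// PN.
  have GDA : <<s G >> (D @^-1` A) by have := GD measurableT _ mA; rewrite setTI.
  rewrite [X in X - _](GH HN GDA); apply: subee.
  by rewrite fin_numM ?fin_num_measure.
have IDi : P.-integrable setT (fun w => (I w * D w)%:E).
  have := integrableB measurableT NDi cDi; apply: eq_integrable => // w _.
  by rewrite -!EFinM -EFinB -mulrBl.
have := integral_mul_comp mD Ii I0 (@measurable_id _ _ setT) IDi.
under eq_integral do rewrite mulrBl EFinB !EFinM.
rewrite integralB// [X in _ - X]integralZl// D0 mule0 sube0 => <-.
rewrite [LHS]integral_mkcond; apply: eq_integral => w _.
by rewrite epatch_indic/= muleC.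
Qed.

(** A pi-system that generates the events determined jointly by [X] and the noise. *)
Definition rv_noise_events : set (set Omega) :=
  [set U | exists A N, [/\ measurable A, <<s H >> N & U = X @^-1` A `&` N]].

(** The measurable sets on which [D] has zero integral form a Dynkin class, closed under complement
    because [E[D] = 0]; it remains to treat the pi-system. *)
Lemma integral_rv_noise_event (D : Omega -> R) (U : set Omega) :
  square_integrable P D ->
  measurable_fun setT (D : g_sigma_algebraType G -> R) ->
  measurable_fun setT (X : g_sigma_algebraType G -> S) ->
  (forall A, measurable A -> \int[P]_(w in X @^-1` A) (D w)%:E = 0) ->
  <<s rv_noise_events >> U -> \int[P]_(w in U) (D w)%:E = 0.
Proof.
move=> D2 GD GX D0.
have [mD _] := D2; have Di := square_integrable_integrable D2.
have DiS A : measurable A -> P.-integrable A (fun w => (D w)%:E).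
  by move=> mA; exact: integrableS Di.
suff: <<s rv_noise_events >> `<=`
    [set U | measurable U /\ \int[P]_(w in U) (D w)%:E = 0].
  by move=> /[apply] -[].
rewrite -setI_closed_g_dynkin_g_sigma_algebra; last first.
  move=> _ _ [A [N [mA HN ->]]] [A' [N' [mA' HN' ->]]].
  exists (A `&` A'), (N `&` N'); split; first exact: measurableI.
  - by apply: (@measurableI _ (g_sigma_algebraType H)).
  - by rewrite preimage_setI setIACA.
apply: smallest_sub; first split.
- by split => //; have := D0 _ measurableT; rewrite preimage_setT.
- move=> A [mA A0]; have mCA : measurable (~` A) by exact: measurableC.
  split => //; have := D0 _ measurableT; rewrite preimage_setT -(setUv A).
  rewrite integral_setU//; first by rewrite A0 add0e.
  + exact/measurable_EFinP/measurable_funTS.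
  + by rewrite /disj_set setICr.
- move=> F tF F0; have mF k : measurable (F k) by case: (F0 k).
  have mUF : measurable (\bigcup_k F k) by exact: bigcup_measurable.
  split => //; rewrite integral_bigcup//; last exact: DiS.
  by apply: eseries0 => k _ _; case: (F0 k).
- move=> _ [A [N [mA HN ->]]].
  have mXA : measurable (X @^-1` A) by exact: measurable_funPTI.
  have mN := measurable_H HN.
  split; first exact: measurableI.
  (* [D1] absorbs the event of [X]: it remains measurable for [G], and its mean is the integral of
     [D] over an event of [X], hence zero. Only the noise event [N] is left, and independence
     handles it. *)
  pose D1 w := (D w * \1_(X @^-1` A) w)%R.
  have -> : \int[P]_(w in X @^-1` A `&` N) (D w)%:E =
            \int[P]_(w in N) (D1 w)%:E.
    rewrite setIC integral_mkcondr; apply: eq_integral => w _.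
    by rewrite epatch_indic.
  apply: integral_independent HN.
  + have mD1 : measurable_fun setT D1 by exact: measurable_funM.
    split => //; case: D2 => _; apply: le_integrable => //.
      exact/measurable_EFinP/measurable_funX.
    move=> w _; rewrite !abse_EFin lee_fin !ger0_norm ?sqr_ge0//.
    by rewrite exprMn ler_piMr ?sqr_ge0.
  + apply: measurable_funM => //.
    apply: (@measurable_indic _ (g_sigma_algebraType G) R).
    by have := GX measurableT _ mA; rewrite setTI.
  + rewrite -(D0 _ mA) [RHS]integral_mkcond; apply: eq_integral => w _.
    by rewrite epatch_indic.
Qed.

End independence_theory.

Lemma sqre_ge0 {R : realDomainType} (x : \bar R) : 0 <= x ^+ 2.
Proof.
by case: x => [r| |]; rewrite expe2 ?mulyy ?mulNyNy// -EFinM lee_fin -expr2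
  sqr_ge0.
Qed.

Lemma emeasurable_sqr d (T : measurableType d) (R : realType)
    (f : T -> \bar R) :
  measurable_fun setT f -> measurable_fun setT (fun x => f x ^+ 2).
Proof.
by move=> mf; under eq_fun do rewrite expe2; exact: emeasurable_funM.
Qed.

(** * Decomposition of the mean squared error of one coordinate *)

Section mse_decomposition.
Context {dO dS : measure_display} {Omega : measurableType dO}
  {S : measurableType dS} {R : realType} (P : probability Omega R)
  (X : {RV P >-> S}).
Variables (Z Y : Omega -> R) (mY : S -> R).
Hypotheses (mZ : measurable_fun setT Z) (Y2 : square_integrable P Y)
  (YmY : is_L2_condexp X Y mY)
  (orth : forall A, measurable A ->
    \int[P]_(w in Z @^-1` A) (Y w - mY (X w))%:E = 0).

Let cZ w := condexp X (EFin \o Z) (X w).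
Let cY w := condexp X (EFin \o Y) (X w).

Let mcZ : measurable_fun setT cZ.
Proof.
apply: measurableT_comp => //.
by apply: measurable_condexp; exact/measurable_EFinP.
Qed.

Let mcY : measurable_fun setT cY.
Proof.
apply: measurableT_comp => //; apply: measurable_condexp.
by apply/measurable_EFinP; case: Y2.
Qed.

Let mZcZ : measurable_fun setT (fun w => ((Z w)%:E - cZ w) ^+ 2).
Proof.
apply: emeasurable_sqr; apply: emeasurable_funB => //.
exact/measurable_EFinP.
Qed.

Let mcZcY : measurable_fun setT (fun w => (cZ w - cY w) ^+ 2).
Proof. by apply: emeasurable_sqr; exact: emeasurable_funB. Qed.

Let square_integrable_decomposition : square_integrable P Z ->
  \int[P]_w ((Z w)%:E - (Y w)%:E) ^+ 2 =
  \int[P]_w (cZ w - cY w) ^+ 2 + \int[P]_w ((Z w)%:E - cZ w) ^+ 2 +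
  \int[P]_w ((Y w - mY (X w)) ^+ 2)%:E.
Proof.
move=> Z2; have [mZ' ZmZ] := exists_L2_condexp X Z2.
have [mmZ aeZ mZX2 ZB] := ZmZ; have [mmY aeY mYX2 YB] := YmY.
pose W w := (Z w - mZ' (X w))%R; pose D w := (Y w - mY (X w))%R.
pose h y := (mZ' y - mY y)%R.
have mh : measurable_fun setT h by exact: measurable_funB.
have W2 : square_integrable P W by exact: square_integrableB.
have D2 : square_integrable P D by exact: square_integrableB.
have h2 : square_integrable P (h \o X) by exact: square_integrableB.
have Wi := square_integrable_integrable W2.
have Di := square_integrable_integrable D2.
have Wh := integrable_mulr W2 h2.
have Dh := integrable_mulr D2 h2.
have DZ := integrable_mulr D2 Z2.
have DmZ := integrable_mulr D2 mZX2.
have Wh0 := integral_mul_comp (measurable_funPT X) Wi ZB mh Wh.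
have Dh0 := integral_mul_comp (measurable_funPT X) Di YB mh Dh.
have DmZ0 := integral_mul_comp (measurable_funPT X) Di YB mmZ DmZ.
have DZ0 := integral_mul_comp mZ Di orth (@measurable_id _ _ setT) DZ.
(* The extended-valued conditional means are replaced by their real versions, so that squares can be
   expanded. *)
rewrite (@ae_eq_integral _ _ _ P setT (fun w => (h (X w) ^+ 2)%:E)
  (fun w => (cZ w - cY w) ^+ 2))//; last 2 first.
- by apply/measurable_EFinP; apply: measurable_funX; case: h2.
- by apply: filterS2 aeZ aeY => w zw yw _; rewrite /cZ /cY zw yw EFin_expe.
rewrite (@ae_eq_integral _ _ _ P setT (fun w => (W w ^+ 2)%:E)
  (fun w => ((Z w)%:E - cZ w) ^+ 2))//; last 2 first.
- by apply/measurable_EFinP; apply: measurable_funX; case: W2.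
- by apply: filterS aeZ => w zw _; rewrite /cZ zw EFin_expe.
have [[_ Wi2] [_ Di2] [_ hi2]] := And3 W2 D2 h2.
(* Half the sum of the cross terms in the square of [Z - Y = W + h(X) - D]. The product [D W] is
   split because [D] is known to be orthogonal to functions of [Z] and to functions of [X]
   separately. *)
pose C w := (W w * h (X w) - D w * h (X w) - (D w * Z w - D w * mZ' (X w)))%R.
have Ci : P.-integrable setT (EFin \o C).
  have := integrableB measurableT (integrableB measurableT Wh Dh)
    (integrableB measurableT DZ DmZ).
  exact: eq_integrable.
have C0 : \int[P]_w (C w)%:E = 0.
  under eq_integral do rewrite /C !EFinB.
  rewrite integralB//; [|exact: integrableB..].
  rewrite integralB// [X in _ - X]integralB//.
  by rewrite Wh0 Dh0 DZ0 DmZ0 !sube0.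
transitivity (\int[P]_w ((h (X w) ^+ 2)%:E + (W w ^+ 2)%:E + (D w ^+ 2)%:E
    + 2%:E * (C w)%:E)).
  apply: eq_integral => w _; rewrite -EFinB -EFin_expe -EFinM -!EFinD.
  by congr _%:E; rewrite /C /W /D /h; ring.
have hW := integrableD measurableT hi2 Wi2.
rewrite integralD//; [|exact: integrableD|exact: integrableZl].
rewrite integralZl// C0 mule0 adde0 integralD// integralD//.
Qed.

Lemma mse_decomposition :
  \int[P]_w ((Z w)%:E - (Y w)%:E) ^+ 2 =
  \int[P]_w (cZ w - cY w) ^+ 2 + \int[P]_w ((Z w)%:E - cZ w) ^+ 2 +
  \int[P]_w ((Y w - mY (X w)) ^+ 2)%:E.
Proof.
have [Z2|nZ2] := pselect (square_integrable P Z).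
  exact: square_integrable_decomposition.
have [mY' _] := Y2; have [mmY aeY mYX2 YB] := YmY.
have sqi (f : Omega -> R) : measurable_fun setT f ->
    \int[P]_w (f w)%:E ^+ 2 < +oo -> square_integrable P f.
  move=> mf fy; split => //; apply/integrableP; split.
    exact/measurable_EFinP/measurable_funX.
  by under eq_integral do rewrite gee0_abs ?lee_fin ?sqr_ge0// EFin_expe.
have intge0 (f : Omega -> \bar R) : 0 <= \int[P]_w f w ^+ 2.
  by apply: integral_ge0 => w _; exact: sqre_ge0.
have nty (x : \bar R) : ~ x < +oo -> x = +oo.
  by move=> /negP; rewrite -leNgt leye_eq => /eqP.
(* A finite left side would make [Z = (Z - Y) + Y] square integrable. *)
transitivity (+oo : \bar R).
  apply: nty => ZYy; apply: nZ2.
  have ZY2 : square_integrable P (fun w => Z w - Y w)%R.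
    by apply: sqi => //; exact: measurable_funB.
  have := square_integrableD ZY2 Y2; congr square_integrable.
  by apply/funext => w; rewrite subrK.
(* A finite right side would do the same through [Z = (Z - cZ) + (cZ - mY(X)) + mY(X)]. *)
apply/esym/nty => sumy; apply: nZ2; move: sumy.
set a := \int[P]_w _; set b := \int[P]_w _; set c := \int[P]_w _ => abcy.
have c0 : 0 <= c by apply: integral_ge0 => w _; rewrite lee_fin sqr_ge0.
have ay : a < +oo.
  by apply: le_lt_trans abcy; rewrite -addeA leeDl// adde_ge0// intge0.
have by_ : b < +oo.
  by apply: le_lt_trans abcy; rewrite addeAC leeDr// adde_ge0// intge0.
have ZcZi : P.-integrable setT (fun w => ((Z w)%:E - cZ w) ^+ 2).
  apply/integrableP; split => //.
  by under eq_integral do rewrite gee0_abs ?sqre_ge0//.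
(* Since [Z] need not be integrable here, [cZ] could be infinite; the finite integral of
   [(Z - cZ)^2] excludes this almost everywhere. *)
have cZfin : {ae P, forall w, cZ w = (fine (cZ w))%:E}.
  have := integrable_ae measurableT ZcZi.
  apply: filterS => w /(_ Logic.I); case: (cZ w) => //.
have mfcZ : measurable_fun setT (fun w => fine (cZ w)).
  exact: measurableT_comp mcZ.
have W2 : square_integrable P (fun w => Z w - fine (cZ w))%R.
  apply: sqi; first exact: measurable_funB.
  apply: le_lt_trans by_; rewrite le_eqVlt; apply/orP; left; apply/eqP.
  apply: ae_eq_integral => //.
    by apply: emeasurable_sqr; apply/measurable_EFinP; exact: measurable_funB.
  by apply: filterS cZfin => w zw _; rewrite [in RHS]zw.
have h2 : square_integrable P (fun w => fine (cZ w) - mY (X w))%R.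
  apply: sqi; first by apply: measurable_funB => //; case: mYX2.
  apply: le_lt_trans ay; rewrite le_eqVlt; apply/orP; left; apply/eqP.
  apply: ae_eq_integral => //.
    apply: emeasurable_sqr; apply/measurable_EFinP.
    apply: measurable_funB => //.
    by case: mYX2.
  by apply: filterS2 cZfin aeY => w zw yw _; rewrite [in RHS]zw /cY yw.
have := square_integrableD (square_integrableD W2 h2) mYX2.
congr square_integrable; apply/funext => w /=; ring.
Qed.

End mse_decomposition.

(** * Norms, conditional means and covariance traces by coordinates *)

Section vectors.
Context {dO dS : measure_display} {Omega : measurableType dO}
  {S : measurableType dS} {R : realType} {d : nat} (P : probability Omega R)
  (X : {RV P >-> S}).

Lemma sqnorm_ge0 (v : 'I_d -> \bar R) : 0 <= sqnorm v.
Proof. by apply: sume_ge0 => i _; exact: sqre_ge0. Qed.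

Lemma measurable_sqnorm d' (T : measurableType d') (v : T -> 'I_d -> \bar R) :
  (forall i, measurable_fun setT (v ^~ i)) ->
  measurable_fun setT (fun w => sqnorm (v w)).
Proof. by move=> mv; apply: emeasurable_sum => i; exact: emeasurable_sqr. Qed.

Lemma integral_sqnorm d' (T : measurableType d')
    (mu : {measure set T -> \bar R}) (v : T -> 'I_d -> \bar R) :
  (forall i, measurable_fun setT (v ^~ i)) ->
  \int[mu]_w sqnorm (v w) = \sum_(i < d) \int[mu]_w v w i ^+ 2.
Proof.
move=> mv; rewrite ge0_integral_sum// => [i|i w _].
  exact: emeasurable_sqr.
exact: sqre_ge0.
Qed.

Lemma measurable_evec d' (T : measurableType d') (Z : T -> d.-tuple R) i :
  measurable_fun setT Z -> measurable_fun setT (fun w => evec (Z w) i).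
Proof.
move=> mZ; apply/measurable_EFinP.
exact: (measurableT_comp (measurable_tnth i) mZ).
Qed.

Lemma measurable_condmean (Z : Omega -> d.-tuple R) i :
  measurable_fun setT Z -> measurable_fun setT (fun y => condmean X Z y i).
Proof. by move=> mZ; apply: measurable_condexp; exact: measurable_evec. Qed.

Lemma measurable_condmean_rv (Z : Omega -> d.-tuple R) i :
  measurable_fun setT Z -> measurable_fun setT (fun w => condmean X Z (X w) i).
Proof.
by move=> /(@measurable_condmean _ i) mc; exact: (measurableT_comp mc).
Qed.

(** Tower property on each diagonal entry. These entries are first replaced, almost everywhere, by
    nonnegative versions, which allows sum and integral to be exchanged. *)
Lemma integral_tr_condcov (Z : Omega -> d.-tuple R) :
  measurable_fun setT Z ->
  \int[P]_w (\tr (condcov X Z (X w)))%R =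
  \sum_(i < d) \int[P]_w (evec (Z w) i - condmean X Z (X w) i) ^+ 2.
Proof.
move=> mZ.
pose f i w := (evec (Z w) i - condmean X Z (X w) i) ^+ 2.
have mf i : measurable_fun setT (f i).
  apply: emeasurable_sqr; apply: emeasurable_funB; first exact: measurable_evec.
  exact: measurable_condmean_rv.
have f0 i w : 0 <= f i w by exact: sqre_ge0.
have gP i := ge0_condexpP X (mf i) (f0 i).
have mg i : measurable_fun setT (fun w => ge0_condexp X (f i) (X w)).
  by apply: measurableT_comp => //; case: (gP i).
have trE w : (\tr (condcov X Z (X w)))%R = \sum_(i < d) condexp X (f i) (X w).
  by apply: eq_bigr => i _; rewrite mxE.
under eq_integral do rewrite trE.
transitivity (\int[P]_w \sum_(i < d) ge0_condexp X (f i) (X w)).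
  apply: ae_eq_integral => //.
  - apply: emeasurable_sum => i; apply: measurableT_comp => //.
    exact: measurable_condexp.
  - exact: emeasurable_sum.
  - have : {ae P, forall w, forall i : 'I_d,
        condexp X (f i) (X w) = ge0_condexp X (f i) (X w)}.
      by apply: filter_forall => i; exact: ae_condexp_ge0.
    by apply: filterS => w fw _; apply: eq_bigr.
rewrite ge0_integral_sum//; last by move=> i w _; case: (gP i).
apply: eq_bigr => i _.
have := integral_ge0_condexp X (mf i) (f0 i) measurableT.
by rewrite preimage_setT.
Qed.

End vectors.

(* Young's inequality [(a - b)^2 <= (1 + eta) a^2 + (1 + 1/eta) b^2], with
   [a = u - c] and [b = t - c]. *)
Lemma sqre_sub_le {R : realType} (eta t c : R) (u : \bar R) : (0 < eta)%R ->
  (u - t%:E) ^+ 2 <=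
  (1 + eta)%:E * (u - c%:E) ^+ 2 + (1 + eta^-1)%:E * (t%:E - c%:E) ^+ 2.
Proof.
move=> eta0; have h1 : (0 < 1 + eta)%R by rewrite ltr_wpDl.
have h2 : (0 < 1 + eta^-1)%R by rewrite ltr_wpDl// invr_gt0.
case: u => [u| |]; rewrite -EFinB -(EFin_expe (t - c)).
- rewrite -!EFinB -!EFin_expe -!EFinM -EFinD lee_fin -subr_ge0.
  rewrite [leRHS](_ : _ = eta * ((u - c) + (t - c) / eta) ^+ 2)%R.
    by rewrite mulr_ge0 ?sqr_ge0// ltW.
  by field; rewrite gt_eqF.
- by rewrite addye// !expe2 mulyy gt0_muley ?lte_fin// addye// leey.
- by rewrite addNye !expe2 mulNyNy gt0_muley ?lte_fin// addye// leey.
Qed.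

(** Young's inequality on each coordinate. It is applied where [t] and [c] are finite; [u] may be
    infinite, and then so is the bound. *)
Lemma integral_sqnorm_sub_le {dO : measure_display} {Omega : measurableType dO}
    {R : realType} {d : nat} (P : {measure set Omega -> \bar R}) (eta : R)
    (u t c : Omega -> 'I_d -> \bar R) : (0 < eta)%R ->
  (forall i, measurable_fun setT (u ^~ i)) ->
  (forall i, measurable_fun setT (t ^~ i)) ->
  (forall i, measurable_fun setT (c ^~ i)) ->
  (forall i, {ae P, forall w, t w i \is a fin_num}) ->
  (forall i, {ae P, forall w, c w i \is a fin_num}) ->
  \int[P]_w sqnorm (u w \- t w) <=
  (1 + eta)%:E * \int[P]_w sqnorm (u w \- c w) +
  (1 + eta^-1)%:E * \int[P]_w sqnorm (t w \- c w).
Proof.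
move=> eta0 mu mt mc tfin cfin.
have h1 : (0 <= 1 + eta)%R by rewrite addr_ge0// ltW.
have h2 : (0 <= 1 + eta^-1)%R by rewrite addr_ge0// invr_ge0 ltW.
have mut i : measurable_fun setT (fun w => (u w \- t w) i).
  exact: emeasurable_funB.
have muc i : measurable_fun setT (fun w => (u w \- c w) i).
  exact: emeasurable_funB.
have mtc i : measurable_fun setT (fun w => (t w \- c w) i).
  exact: emeasurable_funB.
rewrite !integral_sqnorm// !ge0_sume_distrr; last 2 first.
- by move=> i _; apply: integral_ge0 => w _; exact: sqre_ge0.
- by move=> i _; apply: integral_ge0 => w _; exact: sqre_ge0.
rewrite -big_split/=; apply: lee_sum => i _.
have m1 := emeasurable_sqr (muc i); have m2 := emeasurable_sqr (mtc i).
rewrite -!ge0_integralZl//; try by move=> w _; exact: sqre_ge0.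
rewrite -ge0_integralD//; last 4 first.
- by move=> w _; rewrite mule_ge0 ?lee_fin// sqre_ge0.
- by apply: measurable_funeM.
- by move=> w _; rewrite mule_ge0 ?lee_fin// sqre_ge0.
- by apply: measurable_funeM.
apply: ae_ge0_le_integral => //.
- by move=> w _; exact: sqre_ge0.
- exact: emeasurable_sqr.
- by move=> w _; rewrite adde_ge0// mule_ge0 ?lee_fin// sqre_ge0.
- by apply: emeasurable_funD; exact: measurable_funeM.
- apply: filterS2 (tfin i) (cfin i) => w /fineK tw /fineK cw _ /=.
  by rewrite -tw -cw; exact: sqre_sub_le.
Qed.

(** * Two families of losses that agree up to a factor and a vanishing error *)

Section long_lead_comparison.
Context {R : realType} {Theta : Type}.
Variables (L A : nat -> Theta -> \bar R) (delta : nat -> \bar R).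
Hypotheses (L0 : forall m th, 0 <= L m th) (A0 : forall m th, 0 <= A m th)
  (delta_cvg : delta @ \oo --> 0).
Hypothesis LA : forall eta : R, (0 < eta)%R -> forall m th,
  L m th <= (1 + eta)%:E * A m th + (1 + eta^-1)%:E * delta m.
Hypothesis AL : forall eta : R, (0 < eta)%R -> forall m th,
  A m th <= (1 + eta)%:E * L m th + (1 + eta^-1)%:E * delta m.

Let small_delta (k e : R) : (0 < k)%R -> (0 < e)%R ->
  \forall m \near \oo, k%:E * delta m <= e%:E.
Proof.
move=> k0 e0.
have /delta_cvg dlt : nbhs (0 : \bar R) [set x | x < (e / k)%:E].
  by apply: open_ereal_lt'; rewrite lte_fin divr_gt0.
have {}dlt : \forall m \near \oo, delta m < (e / k)%:E := dlt.
by apply: filterS dlt => m /ltW dm; rewrite muleC -lee_pdivlMr// EFinM.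
Qed.

(** First [eta] is fixed, so that the relative error is small on values up to [K]; then [m] is taken
    large enough for [(1 + 1/eta) delta m <= s]. This threshold is the same for all parameters. *)
Let near_comparison (K e : R) : (0 < e)%R -> exists eta s : R,
  [/\ (0 < eta)%R, (0 < s)%R, (3 * (eta * `|K|) + 3 * s < e)%R, (eta <= 1)%R &
  \forall m \near \oo, forall th,
    L m th <= (1 + eta)%:E * A m th + s%:E /\
    A m th <= (1 + eta)%:E * L m th + s%:E].
Proof.
move=> e0; have K1 : (0 < `|K| + 1)%R by rewrite ltr_wpDl.
(* With [s = e / 8], the required sum is at most [6 e / 8]; the [+ 1] covers [K = 0], and [eta <= 1]
   later bounds [eta^2] by [eta]. *)
pose eta := Num.min 1%R (e / (8 * (`|K| + 1)))%R.
have eta0 : (0 < eta)%R by rewrite lt_min ltr01/= divr_gt0// mulr_gt0.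
have etaK : (eta * (`|K| + 1) <= e / 8)%R.
  rewrite -ler_pdivlMr// (_ : _ / 8 / _ = e / (8 * (`|K| + 1)))%R.
    by rewrite ge_min lexx orbT.
  by field; rewrite gt_eqF.
have k0 : (0 < 1 + eta^-1)%R by rewrite addr_gt0// invr_gt0.
have s0 : (0 < e / 8)%R by rewrite divr_gt0.
exists eta, (e / 8)%R; split => //.
- have := mulr_ge0 (ltW eta0) (normr_ge0 K); nra.
- by rewrite ge_min lexx.
- apply: filterS (small_delta k0 s0) => m dm th; split.
    by apply: le_trans (LA eta0 m th) _; rewrite leeD2l.
  by apply: le_trans (AL eta0 m th) _; rewrite leeD2l.
Qed.

Let finite_le (x : \bar R) (K : R) : 0 <= x -> x <= K%:E ->
  exists2 a : R, x = a%:E & (0 <= a <= K)%R.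
Proof.
by case: x => // a; rewrite !lee_fin => a0 aK; exists a => //; apply/andP.
Qed.

(** With [a] and [l] the values of [A] and [L], [l - a <= eta a + s] and
    [a - l <= eta l + s <= 2 eta a + 2 s]. *)
Lemma near_abs_sub_le (K e : R) : (0 < e)%R ->
  \forall m \near \oo, forall th, A m th <= K%:E ->
    `|L m th - A m th| <= e%:E.
Proof.
move=> e0; have [eta [s [eta0 s0 se eta1 near_LA]]] := near_comparison K e0.
apply: filterS near_LA => m + th AK => /(_ th)[].
have [a -> /andP[a0 aK]] := finite_le (A0 m th) AK.
rewrite -EFinM -EFinD => /(finite_le (L0 m th))[l -> /andP[l0 la]].
rewrite -EFinM -EFinD lee_fin => al.
rewrite -EFinB abse_EFin lee_fin ler_norml.
have ea : (eta * a <= eta * `|K|)%R.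
  by rewrite ler_pM2l// (le_trans aK)// ler_norm.
have el : (eta * l <= 2 * (eta * a) + s)%R.
  have := ler_wpM2l (ltW eta0) la; have := ler_wpM2r (ltW s0) eta1.
  have := ler_wpM2r (mulr_ge0 (ltW eta0) a0) eta1; nra.
by apply/andP; split; nra.
Qed.

(** If [L m th' <= L m th], chaining the two comparisons gives
    [A m th' <= a + 3 eta a + 3 s < a + e] with [a = A m th], against the assumed gap. This is the
    source of the factors 3 in [near_comparison]. *)
Lemma near_lt (K e : R) : (0 < e)%R ->
  \forall m \near \oo, forall th th', A m th <= K%:E ->
    A m th + e%:E <= A m th' -> L m th < L m th'.
Proof.
move=> e0; have [eta [s [eta0 s0 se eta1 near_LA]]] := near_comparison K e0.
apply: filterS near_LA => m near_m th th' AK; rewrite ltNge => AA.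
apply/negP => LL; move: (near_m th) (near_m th') AA => [+ _] [_ +].
have [a -> /andP[a0 aK]] := finite_le (A0 m th) AK.
rewrite -EFinM -EFinD => /(finite_le (L0 m th))[l le /andP[l0 la]].
move: LL; rewrite le => /(finite_le (L0 m th'))[l' -> /andP[l'0 l'l]].
rewrite -EFinM -EFinD => /(finite_le (A0 m th'))[a' -> /andP[a'0 al']].
rewrite -EFinD lee_fin.
have ea : (eta * a <= eta * `|K|)%R.
  by rewrite ler_pM2l// (le_trans aK)// ler_norm.
have el : (eta * l <= 2 * (eta * a) + s)%R.
  have := ler_wpM2l (ltW eta0) la; have := ler_wpM2r (ltW s0) eta1.
  have := ler_wpM2r (mulr_ge0 (ltW eta0) a0) eta1; nra.
have := ler_wpM2l (ltW eta0) l'l; nra.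
Qed.

Let cvg0_of_le (u v : nat -> \bar R) : (forall m, 0 <= u m) ->
  (forall m, u m <= (1 + 1)%:E * v m + (1 + 1^-1)%:E * delta m) ->
  v @ \oo --> 0 -> u @ \oo --> 0.
Proof.
move=> u0 uv v0; apply: squeeze_cvge (cvg_cst 0) _.
  by apply: nearW => m; rewrite u0; exact: uv.
rewrite -[X in _ --> X](add0e 0) -[X in _ --> X + _](mule0 (1 + 1)%:E).
rewrite -[X in _ --> _ + X](mule0 (1 + 1^-1)%:E).
by apply: cvgeD; [rewrite !mule0|exact: cvgeZl|exact: cvgeZl].
Qed.

(** For convergence to 0 a bounded factor is harmless, so [eta = 1] suffices. *)
Lemma cvg0_iff (th : nat -> Theta) :
  (fun m => L m (th m)) @ \oo --> 0 <-> (fun m => A m (th m)) @ \oo --> 0.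
Proof.
by split; apply: cvg0_of_le => // m; [exact: AL|exact: LA].
Qed.

End long_lead_comparison.

Lemma cvg0_adde_ge0 {R : realType} (u v : nat -> \bar R) :
  (forall m, 0 <= u m) -> (forall m, 0 <= v m) ->
  (fun m => u m + v m) @ \oo --> 0 <-> u @ \oo --> 0 /\ v @ \oo --> 0.
Proof.
move=> u0 v0; split => [uv|[u_ v_]].
  split; apply: squeeze_cvge (cvg_cst 0) uv; apply: nearW => m.
    by rewrite u0 leeDl.
  by rewrite v0 leeDr.
by rewrite -[X in _ --> X](add0e 0); apply: cvgeD.
Qed.

(** * Measurability with respect to generated sigma-algebras *)

Section generated_measurability.
Context {dO dE : measure_display} {Omega : measurableType dO}
  {E : measurableType dE} {R : realType} {d : nat} (P : probability Omega R).

Lemma measurable_fun_generated d' (T : measurableType d') (f : Omega -> T)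
    (K : set (set Omega)) : K `<=` measurable ->
  measurable_fun setT (f : g_sigma_algebraType K -> T) -> measurable_fun setT f.
Proof.
move=> mK mf _ B mB; have /(_ measurableT _ mB) := mf.
by apply: smallest_sub => //; exact: sigma_algebra_measurable.
Qed.

Lemma measurable_sigma_process (I : Type) d' (T : measurableType d')
    (x : I -> {RV P >-> T}) (i : I) :
  let K := \bigcup_i preimage_set_system setT (x i) measurable in
  measurable_fun setT (x i : g_sigma_algebraType K -> T).
Proof.
by move=> K _ B mB; apply: sub_sigma_algebra; exists i => //; exists B.
Qed.

(** Leaving [K] arbitrary allows the sigma-algebra of the initial state and the noise alone, which
    is finer information than measurability on [Omega]. *)
Lemma measurable_model (K : set (set Omega))
    (f : {mfun (d.-tuple R * E)%type >-> d.-tuple R})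
    (s : {RV P >-> d.-tuple R}) (xi : nat -> {RV P >-> E}) (k : nat) :
  measurable_fun setT (s : g_sigma_algebraType K -> d.-tuple R) ->
  (forall j, measurable_fun setT (xi j : g_sigma_algebraType K -> E)) ->
  measurable_fun setT (model f s xi k : g_sigma_algebraType K -> d.-tuple R).
Proof.
move=> Ks Kxi; elim: k => [//|k IH] /=.
by apply: measurableT_comp => //; exact: measurable_fun_pair.
Qed.

End generated_measurability.

(** * The residual of the truth has zero mean on forecast events *)

Section forecast_orthogonality.
Context {dT dO dE : measure_display} {T : measurableType dT}
  {Omega : measurableType dO} {E : measurableType dE} {R : realType} {d : nat}.
Variables (P : probability Omega R) (cg : {mfun T >-> d.-tuple R})
  (x : nat -> {RV P >-> T}) (xi : nat -> {RV P >-> E}) (n : nat).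
Hypothesis xi_x_indep :
  independent_sigma P (sigma_process xi) (sigma_process x).

Let X := resolved cg x n.
Let G := \bigcup_i preimage_set_system setT (x i) measurable.
Let H := \bigcup_i preimage_set_system setT (xi i) measurable.

Let mH : H `<=` measurable.
Proof. by move=> _ [k _ [B mB <-]]; exact: measurable_funP. Qed.

Let measurable_model_noise f k : measurable_fun setT
  (model f X xi k : g_sigma_algebraType (rv_noise_events X H) -> d.-tuple R).
Proof.
(* An event of [X] alone or of one noise variable is a generator whose other factor is the whole
   space. *)
apply: measurable_model => [_ B mB|j _ B mB]; apply: sub_sigma_algebra.
  exists B, setT; split => //; last by rewrite setTI setIT.
  exact: (@measurableT _ (g_sigma_algebraType H)).
exists setT, (xi j @^-1` B); split => //.
by have := @measurable_sigma_process _ _ _ P _ _ _ xi j measurableT B mB;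
  rewrite setTI.
Qed.

Lemma measurable_forecast f k : measurable_fun setT (model f X xi k).
Proof.
apply: measurable_fun_generated (measurable_model_noise f k).
move=> _ [A [N [mA HN ->]]]; apply: measurableI; first exact: measurable_funPTI.
move: N HN; apply: smallest_sub => //; exact: sigma_algebra_measurable.
Qed.

Let measurable_resolved k : measurable_fun setT
  (resolved cg x k : g_sigma_algebraType G -> d.-tuple R).
Proof. by apply: measurableT_comp => //; exact: measurable_sigma_process. Qed.

(** The event is determined by [X] and the noise, the residual by the true system; this supplies the
    hypothesis [orth] of the decomposition. *)
Lemma integral_forecast_event f k l (i : 'I_d) (m : d.-tuple R -> R)
    (A : set R) :
  square_integrable P (fun w => tnth (resolved cg x l w) i) ->
  is_L2_condexp X (fun w => tnth (resolved cg x l w) i) m -> measurable A ->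
  \int[P]_(w in (fun w => tnth (model f X xi k w) i) @^-1` A)
    (tnth (resolved cg x l w) i - m (X w))%:E = 0.
Proof.
move=> Y2 [mm _ m2 D0] mA.
apply: (integral_rv_noise_event (X := X) xi_x_indep mH) => //.
- exact: square_integrableB.
- apply: measurable_funB.
    exact: (measurableT_comp (measurable_tnth i) (measurable_resolved l)).
  exact: (measurableT_comp mm (measurable_resolved n)).
- exact: measurable_resolved.
- have := measurableT_comp (measurable_tnth i) (measurable_model_noise f k).
  by move=> /(_ measurableT A mA); rewrite setTI.
Qed.

End forecast_orthogonality.

(** * The decomposition and its long-lead consequences *)

Theorem proposition1
  (R : realType) (d : nat)
  (dT dO dE : measure_display) (T : measurableType dT)
  (Omega : measurableType dO) (E : measurableType dE)
  (* the true system and its coarse-graining *)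
  (mu : probability T R) (Phi : {mfun T >-> T})
  (Phi_mu : forall A, measurable A -> mu (Phi @^-1` A) = mu A)
  (cg : {mfun T >-> d.-tuple R})
  (cg_L2 : \int[distribution mu cg]_y sqnorm (evec y) < +oo)
  (* a stationary trajectory with law mu *)
  (P : probability Omega R) (x : nat -> {RV P >-> T})
  (x_dyn : forall k w, x k.+1 w = Phi (x k w))
  (x_law : forall k A, measurable A -> distribution P (x k) A = mu A)
  (* the parametrized model and its noise *)
  (Theta : Type) (F : Theta -> {mfun (d.-tuple R * E)%type >-> d.-tuple R})
  (xi : nat -> {RV P >-> E}) (n : nat)
  (xi_indep : mutually_independent (fun k => xi (n + k)%N))
  (xi_x_indep : independent_sigma P
     (sigma_process (fun k => xi (n + k)%N)) (sigma_process x))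
  (* decorrelation, in L^2 of the resolved invariant law *)
  (decorrelation :
     (fun m : nat => \int[distribution mu cg]_y
        sqnorm (condmean (resolved cg x n) (resolved cg x (n + m)%N) y
                \- mean_vec (distribution mu cg))) @ \oo --> 0) :
  let X := resolved cg x n in
  let truth (m : nat) : Omega -> d.-tuple R := resolved cg x (n + m)%N in
  let forecast (m : nat) (th : Theta) : Omega -> d.-tuple R :=
    model (F th) X (fun k => xi (n + k)%N) m in
  let clim := mean_vec (distribution mu cg) in
  let loss (m : nat) (th : Theta) :=
    \int[P]_w sqnorm (evec (forecast m th w) \- evec (truth m w)) in
  let bias (m : nat) (th : Theta) :=
    \int[P]_w sqnorm (condmean X (forecast m th) (X w)
                      \- condmean X (truth m) (X w)) in
  let spread (m : nat) (th : Theta) :=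
    \int[P]_w (\tr (condcov X (forecast m th) (X w)))%R in
  let clim_bias (m : nat) (th : Theta) :=
    \int[P]_w sqnorm (condmean X (forecast m th) (X w) \- clim) in
  exists C : nat -> R,
  (* decomposition, with a remainder that does not depend on the parameter *)
  (forall m th, loss m th = bias m th + spread m th + (C m)%:E) /\
  (* predictive variance is a nonnegative contribution *)
  (forall m th, 0 <= spread m th) /\
  (* the target conditional mean tends to climatology in L^2 *)
  ((fun m : nat => \int[distribution mu cg]_y
     sqnorm (condmean X (truth m) y \- clim)) @ \oo --> 0) /\
  (* at long leads, the parameter-dependent part of the loss is the spread plus
     the squared distance of the predictive mean to climatology, uniformly over
     parameters for which the latter is bounded *)
  (forall K e : R, (0 < e)%R -> \forall m \near \oo, forall th,
     clim_bias m th + spread m th <= K%:E ->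
     `|(loss m th - (C m)%:E) - (clim_bias m th + spread m th)| <= e%:E) /\
  (* hence long-lead losses favor smaller spread and distance to climatology *)
  (forall K e : R, (0 < e)%R -> \forall m \near \oo, forall th th',
     clim_bias m th + spread m th <= K%:E ->
     clim_bias m th + spread m th + e%:E <= clim_bias m th' + spread m th' ->
     loss m th < loss m th') /\
  (* and the parameter-dependent part of the loss vanishes exactly when the
     spread vanishes and the predictive mean tends to climatology *)
  (forall th : nat -> Theta,
     ((fun m => loss m (th m) - (C m)%:E) @ \oo --> 0) <->
     ((fun m => spread m (th m)) @ \oo --> 0) /\
     ((fun m => clim_bias m (th m)) @ \oo --> 0)).
Proof.
move=> X truth forecast clim loss bias spread clim_bias.
pose nu := distribution mu cg.
(* Stationarity: every resolved state has law [nu], so moments of the truth are read off [cg_L2]. *)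
have law k (f : d.-tuple R -> \bar R) : measurable_fun setT f ->
    (forall y, 0 <= f y) ->
    \int[P]_w f (resolved cg x k w) = \int[nu]_y f y.
  move=> mf f0; rewrite -(ge0_integral_distribution (resolved cg x k) mf f0).
  apply: eq_measure_integral => B mB _.
  by rewrite /nu -[RHS](x_law k)//; exact: measurable_funPTI.
have nu2 i : square_integrable nu (fun y => tnth y i).
  have mi : measurable_fun setT (fun y : d.-tuple R => tnth y i).
    exact: measurable_tnth.
  split=> //; apply/integrableP; split.
    exact/measurable_EFinP/measurable_funX.
  apply: le_lt_trans cg_L2; apply: ge0_le_integral => //.
  - apply: measurableT_comp => //.
    exact/measurable_EFinP/measurable_funX.
  - apply: measurable_sqnorm => j.
    exact: (measurable_evec j (@measurable_id _ _ setT)).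
  - move=> y _; rewrite gee0_abs ?lee_fin ?sqr_ge0// /sqnorm (bigD1 i)//=.
    rewrite EFin_expe leeDl//.
    by apply: sume_ge0 => j _; rewrite -expe2 sqre_ge0.
have mtruth m : measurable_fun setT (truth m) by exact: measurable_funPT.
have truth2 m i : square_integrable P (fun w => tnth (truth m w) i).
  have [mi /integrableP[_ nui]] := nu2 i; split.
    exact: measurableT_comp mi (mtruth m).
  apply/integrableP; split.
    apply/measurable_EFinP/measurable_funX.
    exact: measurableT_comp mi (mtruth m).
  rewrite (law _ (fun y => `|(tnth y i ^+ 2)%:E|))//.
  apply: measurableT_comp => //.
  exact/measurable_EFinP/measurable_funX.
have clim_fin i : clim i \is a fin_num.
  apply: integrable_fin_num => //.
  exact: square_integrable_integrable (nu2 i).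
have mforecast m th : measurable_fun setT (forecast m th).
  exact: measurable_forecast.
pose p m i := projT1 (cid (exists_L2_condexp X (truth2 m i))).
have pP m i : is_L2_condexp X (fun w => tnth (truth m w) i) (p m i).
  by rewrite /p; case: cid.
(* The expected conditional variance of a true coordinate. Its finiteness makes [C m] a real number,
   which can be subtracted even from an infinite loss. *)
pose v m i := \int[P]_w ((tnth (truth m w) i - p m i (X w)) ^+ 2)%:E.
have v_fin m i : v m i \is a fin_num.
  apply: integrable_fin_num => //; have [_ _ p2 _] := pP m i.
  by have [] := square_integrableB (truth2 m i) p2.
pose C m := (\sum_(i < d) fine (v m i))%R.
have CE m : (C m)%:E = \sum_(i < d) v m i.
  by rewrite /C -sumEFin; apply: eq_bigr => i _; rewrite fineK.
have mM m th i :
    measurable_fun setT (fun w => condmean X (forecast m th) (X w) i).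
  exact: measurable_condmean_rv.
have mT m i : measurable_fun setT (fun w => condmean X (truth m) (X w) i).
  exact: measurable_condmean_rv.
have dec m th : loss m th = bias m th + spread m th + (C m)%:E.
  rewrite /loss /bias /spread CE !integral_sqnorm; last 2 first.
  - by move=> i; exact: emeasurable_funB.
  - by move=> i; apply: emeasurable_funB; exact: measurable_evec.
  rewrite integral_tr_condcov// -!big_split/=; apply: eq_bigr => i _.
  apply: (mse_decomposition (X := X) (Z := fun w => tnth (forecast m th w) i)
    (Y := fun w => tnth (truth m w) i)) => //.
  - exact: (measurableT_comp (measurable_tnth i)).
  - move=> A mA.
    exact: (integral_forecast_event xi_x_indep _ _ (truth2 m i) (pP m i)).
have spread0 m th : 0 <= spread m th.
  rewrite /spread integral_tr_condcov//; apply: sume_ge0 => i _.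
  by apply: integral_ge0 => w _; exact: sqre_ge0.
have bias0 m th : 0 <= bias m th.
  by apply: integral_ge0 => w _; exact: sqnorm_ge0.
have clim_bias0 m th : 0 <= clim_bias m th.
  by apply: integral_ge0 => w _; exact: sqnorm_ge0.
pose delta m := \int[P]_w sqnorm (condmean X (truth m) (X w) \- clim).
have deltaE m : delta m = \int[nu]_y sqnorm (condmean X (truth m) y \- clim).
  rewrite -(law n)// => [|y]; last exact: sqnorm_ge0.
  apply: measurable_sqnorm => i; apply: emeasurable_funB => //.
  exact: measurable_condmean.
have delta_cvg : delta @ \oo --> 0 by rewrite (funext deltaE).
(* [L] is the parameter-dependent part of the loss, and [A] is its counterpart with climatology in
   place of the true conditional mean. *)
pose L m th := bias m th + spread m th.
pose A m th := clim_bias m th + spread m th.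
have lossL m th : loss m th - (C m)%:E = L m th by rewrite dec addeK.
have Tfin m i : {ae P, forall w, condmean X (truth m) (X w) i \is a fin_num}.
  by have [_ + _ _] := pP m i; apply: filterS => w; rewrite /condmean => ->.
(* The same spread may be added on both sides of Young's inequality because [1 <= 1 + eta]. *)
have add_spread eta m th (a b c : \bar R) : (0 < eta)%R -> 0 <= b ->
    a <= (1 + eta)%:E * b + c ->
    a + spread m th <= (1 + eta)%:E * (b + spread m th) + c.
  move=> eta0 b0 abc; rewrite ge0_muleDr// addeAC leeD//.
  by rewrite -[leLHS]mul1e lee_wpmul2r// lee_fin lerDl ltW.
have LA (eta : R) : (0 < eta)%R -> forall m th,
    L m th <= (1 + eta)%:E * A m th + (1 + eta^-1)%:E * delta m.
  move=> eta0 m th; apply: add_spread => //.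
  by apply: (integral_sqnorm_sub_le (c := fun=> clim)) => // i; exact: aeW.
have AL (eta : R) : (0 < eta)%R -> forall m th,
    A m th <= (1 + eta)%:E * L m th + (1 + eta^-1)%:E * delta m.
  move=> eta0 m th; apply: add_spread => //.
  (* Truth and climatology exchange roles here; the sign of their difference disappears in the
     square. *)
  have -> : delta m = \int[P]_w sqnorm (clim \- condmean X (truth m) (X w)).
    apply: eq_integral => w _; apply: eq_bigr => i _.
    transitivity ((- (condmean X (truth m) (X w) i - clim i)) ^+ 2).
      by rewrite !expe2 muleNN.
    by rewrite fin_num_oppeB// addeC.
  by apply: (integral_sqnorm_sub_le (t := fun=> clim)) => // i; exact: aeW.
have L0 m th : 0 <= L m th by exact: adde_ge0.
have A0 m th : 0 <= A m th by exact: adde_ge0.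
exists C; split; first exact: dec.
split; first exact: spread0.
split; first exact: decorrelation.
split; last split.
- move=> K e e0.
  have := near_abs_sub_le L0 A0 delta_cvg LA AL K e0.
  by apply: filterS => m LAe th; rewrite lossL; exact: LAe.
- move=> K e e0; have := near_lt L0 A0 delta_cvg LA AL K e0.
  apply: filterS => m LL th th' AK AA; rewrite !dec lteD2rE//.
  exact: LL AK AA.
- move=> th.
  have -> : (fun m => loss m (th m) - (C m)%:E) = (fun m => L m (th m)).
    by apply/funext => m; exact: lossL.
  apply: (iff_trans (cvg0_iff L0 A0 delta_cvg LA AL th)).
  apply: (iff_trans (cvg0_adde_ge0 (fun m => clim_bias0 m (th m))
    (fun m => spread0 m (th m)))).
  exact: and_comm.
Qed.
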